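(* Let $d \ge 1$ be an integer and let $T, S, D > 0$ be real numbers. Suppose $\lambda^* \in \mathcal{F}_3(T,S;D)$ achieves the maximum of $\lambda_1$ over $\mathcal{F}_3(T,S;D)$, i.e. $\lambda^*_1 = B_3^+(T,S,D)$. Then $\lambda^*$ takes at most three distinct values (i.e. the set of its coordinates $\{\lambda^*_1,\ldots,\lambda^*_d\}$ has at most three elements).
   Context: $\mathcal{F}_3(T,S;D) := \{\lambda \in \mathbb{R}^d_{>0} : \sum_{i=1}^d \lambda_i = T,\ \sum_{i=1}^d \lambda_i^2 = S,\ \prod_{i=1}^d \lambda_i = D\}$ and $B_3^+(T,S,D) := \max\{\lambda_1 : \lambda \in \mathcal{F}_3(T,S;D)\}$. *)

(* Defs.v *)
From mathcomp Require Import all_boot all_order all_algebra.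
From mathcomp Require Import all_classical reals.

Set Implicit Arguments.
Unset Strict Implicit.
Unset Printing Implicit Defensive.

Import Order.TTheory GRing.Theory Num.Theory.
Local Open Scope classical_set_scope.
Local Open Scope ring_scope.

Definition F3 (R : realType) (d : nat) (T S D : R) : set 'rV[R]_d :=
  [set l | [/\ forall i, 0 < l ord0 i,
               \sum_(i < d) l ord0 i = T,
               \sum_(i < d) l ord0 i ^+ 2 = S &
               \prod_(i < d) l ord0 i = D]].
Arguments F3 {R} d T S D _.

(* Indices start at 0, so this is the coordinate written lambda_1 on paper. *)
Definition coord1 (R : realType) (d : nat) (hd : (1 <= d)%N) (l : 'rV[R]_d) : R :=
  l ord0 (Ordinal hd).

Definition is_max (R : realType) (A : set R) (b : R) : Prop :=
  A b /\ ubound A b.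

(* Relational form of b = B_3^+(T, S, D): no junk value is needed when F3 is
   empty. *)
Definition is_B3plus (R : realType) (d : nat) (hd : (1 <= d)%N) (T S D b : R) :
    Prop :=
  is_max [set coord1 hd l | l in F3 d T S D] b.

(* Main.v *)
Require Import Defs.
From mathcomp Require Import all_boot all_order all_algebra.
From mathcomp Require Import all_classical reals.
From mathcomp Require Import polyrcf ring lra.

Import Order.TTheory GRing.Theory Num.Theory.
Local Open Scope classical_set_scope.
Local Open Scope card_scope.
Local Open Scope ring_scope.

(** If [lam] took four distinct values, three coordinates [a < b < c] other than
    the first one, [x], would be distinct.  Replace [x] by [x + e] and ask for
    new values of [a, b, c] that preserve the sum, the sum of squares and the
    product: their elementary symmetric functions are then prescribed, so they
    must be the roots of a cubic which tends to [(t - a)(t - b)(t - c)] as [e]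
    tends to 0.  Three simple real roots persist under small perturbations (sign
    changes between the roots), so the first coordinate was not maximal. *)

(** For [e <= 1] the powers [e ^+ 2] and [e ^+ 3] are at most [e], so the nonconstant terms add up
    to at least [- (K - 1) * e], while [K * e <= c0]. *)
Lemma cubic_gt0_right (R : realFieldType) (c0 c1 c2 c3 : R) : 0 < c0 ->
  exists2 m, 0 < m & forall e, 0 < e -> e <= m ->
    0 < c0 + c1 * e + c2 * e ^+ 2 + c3 * e ^+ 3.
Proof.
move=> c0_gt0; pose K := 1 + `|c1| + `|c2| + `|c3|.
have K_gt0 : 0 < K by rewrite /K !ltr_wpDr.
exists (Num.min 1 (c0 / K)); first by rewrite lt_min ltr01 divr_gt0.
move=> e e_gt0; rewrite le_min ler_pdivlMr // => /andP[e_le1 eK].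
have e2 : e ^+ 2 <= e by rewrite expr2 ler_piMl // ltW.
have e3 : e ^+ 3 <= e by rewrite exprSr ler_piMl ?exprn_ile1 // ltW.
have bound (c y : R) : 0 <= y -> y <= e -> - (`|c| * e) <= c * y.
  move=> y0 ye; rewrite lerNl; apply: (le_trans (ler_norm _)).
  by rewrite normrN normrM ler_wpM2l // ger0_norm.
have b1 := bound c1 e (ltW e_gt0) (lexx _).
have b2 := bound c2 (e ^+ 2) (exprn_ge0 _ (ltW e_gt0)) e2.
have b3 := bound c3 (e ^+ 3) (exprn_ge0 _ (ltW e_gt0)) e3.
move: eK; rewrite /K; lra.
Qed.

Lemma cubic_ivt (R : rcfType) (s1 s2 s3 u v : R) :
  let q t := t ^+ 3 - s1 * t ^+ 2 + s2 * t - s3 in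
  u <= v -> q u * q v < 0 -> exists2 r, u < r < v & q r = 0.
Proof.
move=> q le_uv quv.
pose p : {poly R} := 'X^3 - s1 *: 'X^2 + s2 *: 'X - s3%:P.
have pE t : p.[t] = q t by rewrite /p /q !hornerE.
have [|r] := @poly_ivtoo _ p _ _ le_uv; first by rewrite !pE.
by rewrite in_itv => uv /rootP; rewrite pE => qr; exists r.
Qed.

(** Subtracting two root equations and cancelling the nonzero difference of the roots gives [d12]
    and [d13]; the same treatment of these two gives [E1]. The other relations follow by
    substitution. *)
Lemma cubic_vieta {R : idomainType} {s1 s2 s3 r1 r2 r3 : R} :
  let q t := t ^+ 3 - s1 * t ^+ 2 + s2 * t - s3 in
  r1 != r2 -> r1 != r3 -> r2 != r3 -> q r1 = 0 -> q r2 = 0 -> q r3 = 0 ->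
  [/\ r1 + r2 + r3 = s1, r1 * r2 + r1 * r3 + r2 * r3 = s2 & r1 * r2 * r3 = s3].
Proof.
move=> q n12 n13 n23 q1 q2 q3.
have d12 : r1 ^+ 2 + r1 * r2 + r2 ^+ 2 - s1 * (r1 + r2) + s2 = 0.
  apply: (@mulfI _ (r1 - r2)); first by rewrite subr_eq0.
  by rewrite mulr0 -[RHS](subrr 0) -{1}q1 -q2 /q; ring.
have d13 : r1 ^+ 2 + r1 * r3 + r3 ^+ 2 - s1 * (r1 + r3) + s2 = 0.
  apply: (@mulfI _ (r1 - r3)); first by rewrite subr_eq0.
  by rewrite mulr0 -[RHS](subrr 0) -{1}q1 -q3 /q; ring.
have E1 : r1 + r2 + r3 = s1.
  apply: (@mulfI _ (r2 - r3)); first by rewrite subr_eq0.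
  apply/eqP; rewrite -subr_eq0; apply/eqP.
  by rewrite -[RHS](subrr 0) -{1}d12 -d13; ring.
have E2 : r1 * r2 + r1 * r3 + r2 * r3 = s2.
  by rewrite -[LHS]addr0 -d12 -E1; ring.
split=> //.
by rewrite -[LHS]subr0 -q1 /q -E1 -E2; ring.
Qed.

Lemma increase_one_of_four {R : rcfType} {x a b c : R} :
  0 < x -> 0 < a -> a < b -> b < c ->
  exists x' a' b' c', [/\ x < x', [/\ 0 < a', 0 < b' & 0 < c'],
    x' + a' + b' + c' = x + a + b + c,
    x' ^+ 2 + a' ^+ 2 + b' ^+ 2 + c' ^+ 2 = x ^+ 2 + a ^+ 2 + b ^+ 2 + c ^+ 2 &
    x' * a' * b' * c' = x * a * b * c].
Proof.
move=> x0 a0 ab bc.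
pose e1 := a + b + c; pose e2 := a * b + a * c + b * c; pose e3 := a * b * c.
(* [q e] is forced by the three constraints when [x] becomes [x + e]. *)
pose q e t := t ^+ 3 - (e1 - e) * t ^+ 2 + (e2 + e * (x - e1) + e ^+ 2) * t
              - e3 * x / (x + e).
(* Multiplying by [x + e > 0] clears the denominator: [(x + e) * q e t] is a cubic in [e] with
   constant term [x * ((t - a) * (t - b) * (t - c))]. Taking [s] to be 1 or -1 covers both signs. *)
have q_sign s t : 0 < s * ((t - a) * (t - b) * (t - c)) ->
    exists2 m, 0 < m & forall e, 0 < e -> e <= m -> 0 < s * q e t.
  move=> st.
  have [|m m0 Hm] := @cubic_gt0_right R
    (s * x * ((t - a) * (t - b) * (t - c)))
    (s * (t ^+ 3 - e1 * t ^+ 2 + e2 * t + x * (t ^+ 2 + (x - e1) * t)))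
    (s * (t ^+ 2 + (x - e1) * t + x * t)) (s * t).
    by rewrite mulrAC mulr_gt0.
  exists m => // e e0 em; have xe : 0 < x + e by rewrite addr_gt0.
  rewrite -(pmulr_lgt0 _ xe); have := Hm e e0 em; congr (_ < _).
  by rewrite /q /e1 /e2 /e3; field; rewrite gt_eqF.
(* Since [0 < u0 < a < u1 < b < u2 < c < u3], the unperturbed cubic alternates in sign at these
   points, starting negative. Positivity of [u0] will make the new roots positive. *)
pose u0 := a / 2; pose u1 := (a + b) / 2; pose u2 := (b + c) / 2.
pose u3 := c + 1.
have [|m0 m0P H0] := q_sign (-1) u0.
  have -> : -1 * ((u0 - a) * (u0 - b) * (u0 - c))
    = (a - u0) * (b - u0) * (c - u0) by ring.
  by rewrite !mulr_gt0 // /u0; lra.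
have [|m1 m1P H1] := q_sign 1 u1.
  have -> : 1 * ((u1 - a) * (u1 - b) * (u1 - c))
    = (u1 - a) * (b - u1) * (c - u1) by ring.
  by rewrite !mulr_gt0 // /u1; lra.
have [|m2 m2P H2] := q_sign (-1) u2.
  have -> : -1 * ((u2 - a) * (u2 - b) * (u2 - c))
    = (u2 - a) * (u2 - b) * (c - u2) by ring.
  by rewrite !mulr_gt0 // /u2; lra.
have [|m3 m3P H3] := q_sign 1 u3.
  by rewrite mul1r !mulr_gt0 // /u3; lra.
pose e := Num.min (Num.min m0 m1) (Num.min m2 m3).
have e_gt0 : 0 < e by rewrite !lt_min m0P m1P m2P m3P.
have [em0 em1 em2 em3] : [/\ e <= m0, e <= m1, e <= m2 & e <= m3].
  by rewrite /e !ge_min !lexx !orbT.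
have {H0 em0} s0 := H0 e e_gt0 em0; have {H1 em1} s1 := H1 e e_gt0 em1.
have {H2 em2} s2 := H2 e e_gt0 em2; have {H3 em3} s3 := H3 e e_gt0 em3.
have opp_sign (y z : R) : 0 < -1 * y -> 0 < 1 * z -> y * z < 0.
  by rewrite mulN1r mul1r oppr_gt0 => y0 z0; rewrite nmulr_rlt0.
have [||r1 /andP[r1l r1r] qr1] := @cubic_ivt R (e1 - e)
    (e2 + e * (x - e1) + e ^+ 2) (e3 * x / (x + e)) u0 u1.
- by rewrite /u0 /u1; lra.
- exact: opp_sign.
have [||r2 /andP[r2l r2r] qr2] := @cubic_ivt R (e1 - e)
    (e2 + e * (x - e1) + e ^+ 2) (e3 * x / (x + e)) u1 u2.
- by rewrite /u1 /u2; lra.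
- by rewrite mulrC; apply: opp_sign.
have [||r3 /andP[r3l r3r] qr3] := @cubic_ivt R (e1 - e)
    (e2 + e * (x - e1) + e ^+ 2) (e3 * x / (x + e)) u2 u3.
- by rewrite /u2 /u3; lra.
- exact: opp_sign.
(* The roots lie in disjoint intervals, so they are distinct and Vieta's formulas apply. *)
have r12 : r1 < r2 by apply: lt_trans r2l.
have r23 : r2 < r3 by apply: lt_trans r3l.
have r10 : 0 < r1 by apply: lt_trans r1l; rewrite divr_gt0.
have [||| E1 E2 E3] := cubic_vieta _ _ _ qr1 qr2 qr3.
- by rewrite lt_eqF.
- by rewrite lt_eqF // (lt_trans r12).
- by rewrite lt_eqF.
exists (x + e), r1, r2, r3; split.
- by rewrite ltrDl.
- by split=> //; [apply: lt_trans r12 | apply: lt_trans r23; apply: lt_trans r12].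
- by rewrite -!addrA [r1 + _]addrA E1 /e1; ring.
- have -> : (x + e) ^+ 2 + r1 ^+ 2 + r2 ^+ 2 + r3 ^+ 2 = (x + e) ^+ 2
    + (r1 + r2 + r3) ^+ 2 - 2 * (r1 * r2 + r1 * r3 + r2 * r3) by ring.
  by rewrite E1 E2 /e1 /e2; ring.
- rewrite -!mulrA [r1 * _]mulrA E3 /e3; field.
  by rewrite gt_eqF // addr_gt0.
Qed.

(** Serves to reduce each constraint on a row changed at four indices to an identity between four
    terms, for sums and products alike. *)
Lemma big_split_four {T : Type} {idx : T} (op : Monoid.com_law idx)
    {I : finType} {i j k l : I} (F : I -> T) : uniq [:: i; j; k; l] ->
  \big[op/idx]_n F n =
    op (op (op (op (F i) (F j)) (F k)) (F l))
       (\big[op/idx]_(n | n \notin [:: i; j; k; l]) F n).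
Proof.
move=> u; rewrite (bigID (mem [:: i; j; k; l])) /= -big_uniq //=.
by rewrite !big_cons big_nil Monoid.mulm1 !Monoid.mulmA.
Qed.

(** Applying [increase_one_of_four] to the first coordinate and the chain, with all other
    coordinates fixed, gives a point of [F3] that exceeds the maximum. *)
Lemma max_coord1_no_chain {R : realType} {d : nat} {hd : (1 <= d)%N} {T S D : R}
    {lam : 'rV[R]_d} {i j k : 'I_d} :
  F3 d T S D lam -> is_B3plus hd T S D (coord1 hd lam) ->
  Ordinal hd \notin [:: i; j; k] ->
  lam ord0 i < lam ord0 j -> lam ord0 j < lam ord0 k -> False.
Proof.
move=> [lam_gt0 sumT sumS prodD] [_ ub] n0 lt_ij lt_jk.
set o := Ordinal hd in n0.
have neq m n : lam ord0 m < lam ord0 n -> (m == n) = false.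
  by case: eqP => // ->; rewrite ltxx.
have uni : uniq [:: o; i; j; k].
  rewrite cons_uniq n0 /= !inE (neq i j) // (neq j k) // (neq i k) //.
  exact: lt_trans lt_jk.
have [x' [a' [b' [c' [x'_gt [a'0 b'0 c'0] Esum Esq Eprod]]]]] :=
  increase_one_of_four (lam_gt0 o) (lam_gt0 i) lt_ij lt_jk.
pose lam' := \row_n (if n == o then x' else if n == i then a' else
  if n == j then b' else if n == k then c' else lam ord0 n).
have lam'o : lam' ord0 o = x' by rewrite mxE eqxx.
move: (uni); rewrite /= !inE !negb_or andbT.
case/and3P=> /and3P[oi oj ok] /andP[ij ik] jk.
have lam'i : lam' ord0 i = a' by rewrite mxE eq_sym (negPf oi) eqxx.
have lam'j : lam' ord0 j = b'.
  by rewrite mxE ![j == _]eq_sym (negPf oj) (negPf ij) eqxx.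
have lam'k : lam' ord0 k = c'.
  by rewrite mxE ![k == _]eq_sym (negPf ok) (negPf ik) (negPf jk) eqxx.
have lam'n n : n \notin [:: o; i; j; k] -> lam' ord0 n = lam ord0 n.
  rewrite !inE !negb_or mxE.
  by case/and4P=> /negPf-> /negPf-> /negPf-> /negPf->.
have : F3 d T S D lam'.
  split.
  - move=> n; rewrite mxE; do 4?case: ifP => // _.
    exact: lt_trans x'_gt.
  - rewrite -sumT !(big_split_four _ _ uni) /= lam'o lam'i lam'j lam'k Esum.
    by congr (_ + _); apply: eq_bigr => n /lam'n->.
  - rewrite -sumS !(big_split_four _ _ uni) /= lam'o lam'i lam'j lam'k Esq.
    by congr (_ + _); apply: eq_bigr => n /lam'n->.
  - rewrite -prodD !(big_split_four _ _ uni) /= lam'o lam'i lam'j lam'k Eprod.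
    by congr (_ * _); apply: eq_bigr => n /lam'n->.
move=> F3lam'; have /= := ub _ (ex_intro2 _ _ _ F3lam' erefl).
by rewrite /coord1 -/o lam'o leNgt x'_gt.
Qed.

(** Values are collected greedily from [f o] on; if three did not suffice, a fourth would contradict
    the hypothesis. *)
Lemma range_card_le3 (I : finType) (T : eqType) (f : I -> T) (o : I) :
  (forall i j k, uniq [:: f o; f i; f j; f k] -> False) ->
  range f #<= `I_3.
Proof.
move=> no4.
have [s size_s sub_s] : exists2 s : seq T, (size s <= 3)%N &
    forall i, f i \in s.
  have step (s : seq T) : (forall i, f i \in s) \/ exists i, f i \notin s.
    have [/forallP|] := boolP [forall i, f i \in s]; first by left.
    by rewrite negb_forall => /existsP; right.
  have [?|[i ni]] := step [:: f o]; first by exists [:: f o].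
  have [?|[j nj]] := step [:: f i; f o]; first by exists [:: f i; f o].
  have [?|[k nk]] := step [:: f j; f i; f o]; first by exists [:: f j; f i; f o].
  case: (no4 i j k); rewrite -rev_uniq.
  by rewrite (_ : rev _ = [:: f k; f j; f i; f o]) //= nk nj ni.
(* The range lies in the image of [I_3] under [nth]; the default [f o] only fills positions past the
   end of [s]. *)
apply: card_le_trans (card_image_le (nth (f o) s) `I_3).
apply: subset_card_le => _ [i _ <-].
exists (index (f i) s); last by rewrite nth_index.
by apply: leq_trans size_s; rewrite index_mem.
Qed.

Theorem theorem4p1 (R : realType) (d : nat) (hd : (1 <= d)%N) (T S D : R)
    (hT : 0 < T) (hS : 0 < S) (hD : 0 < D) (lam : 'rV[R]_d)
    (hlam : F3 d T S D lam)
    (hmax : is_B3plus hd T S D (coord1 hd lam)) :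
  range (fun i : 'I_d => lam ord0 i) #<= `I_3.
Proof.
apply: (@range_card_le3 _ _ _ (Ordinal hd)) => i j k uni.
(* Stated for every ordering of the three indices, so that it applies however their values compare.
   The first index is not among them, since its value differs from theirs. *)
have nchain i' j' k' : perm_eq [:: i; j; k] [:: i'; j'; k'] ->
    lam ord0 i' < lam ord0 j' -> lam ord0 j' < lam ord0 k' -> False.
  move=> pe; apply: (max_coord1_no_chain hlam hmax).
  rewrite -(perm_mem pe); apply: contraL uni => o_in.
  rewrite cons_uniq; apply/nandP; left; rewrite negbK.
  exact: (map_f (fun n => lam ord0 n) o_in).
move: uni; rewrite /= !inE !negb_or => /and4P[_ /andP[ij ik] jk _].
wlog lt_ij : i j ij ik jk nchain / lam ord0 i < lam ord0 j.
  move=> W; case: (ltgtP (lam ord0 i) (lam ord0 j)) (ij) => // h _.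
    exact: (W i j).
  apply: (W j i) => //; first by rewrite eq_sym.
  move=> i' j' k' pe; apply: nchain; apply: perm_trans pe.
  exact: permEl (perm_catCA [:: i] [:: j] [:: k]).
(* With the values at [i] and [j] in increasing order, the value at [k] lies above, between or below
   them. *)
case: (ltgtP (lam ord0 j) (lam ord0 k)) jk => // [h|h] _.
  exact: (nchain i j k).
case: (ltgtP (lam ord0 i) (lam ord0 k)) ik => // [h'|h'] _.
  apply: (nchain i k j) => //; rewrite perm_cons.
  exact: permEl (perm_catC [:: j] [:: k]).
apply: (nchain k i j) => //.
exact: permEl (perm_catC [:: i; j] [:: k]).
Qed.
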